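(* Let $(\bar x,\bar y)$ be an extreme point of $conv(S^U)$. Then there exist $t\in N$ and $p_t\in\{1,\dots,u_t\}$ such that $\bar x_t=p_t$, $\bar y_t=\frac{r}{p_t}$, and, for all $j\in N$ with $j\ne t$, $\bar x_j\in\{0,u_j\}$ and $\bar y_j=0$.
   Context: Let $n\ge 1$, $N=\{1,\dots,n\}$, $r>0$ a real number and $u=(u_1,\dots,u_n)$ a vector of positive integers. Define $$S^U=\Big\{(x,y)\in\mathbb{Z}^n_+\times\mathbb{R}^n_+ : \sum_{i=1}^n x_iy_i\ge r,\ x\le u\Big\},$$ where $\mathbb{R}_+=[0,\infty)$, $\mathbb{Z}_+=\mathbb{Z}\cap[0,\infty)$ and $x\le u$ is componentwise. $conv$ denotes convex hull in $\mathbb{R}^n\times\mathbb{R}^n$. *)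

(* Defs.v *)
From HB Require Import structures.
From mathcomp Require Import all_boot all_order all_algebra.
From mathcomp Require Import interval_inference.
From mathcomp Require Import boolp classical_sets reals convex.

Set Implicit Arguments.
Unset Strict Implicit.
Unset Printing Implicit Defensive.

Import Order.TTheory GRing.Theory Num.Theory.

Local Open Scope classical_set_scope.
Local Open Scope ring_scope.
Local Open Scope convex_scope.

Definition convex_hull (R : numDomainType) (M : lmodType R)
    (A : set (convex_lmodType M)) : set (convex_lmodType M) :=
  smallest (@convex_set R M) A.

Definition extreme_point (R : numDomainType) (M : lmodType R)
    (C : set (convex_lmodType M)) (z : convex_lmodType M) : Prop :=
  C z /\
  forall (a b : convex_lmodType M) (t : {i01 R}),
    C a -> C b -> 0 < t%:num -> t%:num < 1 -> z = a <| t |> b -> a = b.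

(* The integer vector x is embedded in R^n, as the convex hull is taken in
   R^n x R^n; [Num.nat] is the set of nonnegative integers inside R. *)
Definition SU (R : realType) (n : nat) (r : R) (u : 'I_n -> nat) :
    set ('rV[R]_n * 'rV[R]_n) :=
  [set z : 'rV[R]_n * 'rV[R]_n | [/\ forall i, z.1 ord0 i \is a Num.nat,
               forall i, 0 <= z.2 ord0 i,
               r <= \sum_(i < n) z.1 ord0 i * z.2 ord0 i &
               forall i, z.1 ord0 i <= (u i)%:R ]].

(* Main.v *)
Require Import Defs.
From mathcomp Require Import all_boot all_order all_algebra.
From mathcomp Require Import boolp classical_sets reals convex.
From mathcomp Require Import interval_inference ring lra.

Import Order.TTheory GRing.Theory Num.Theory.
Local Open Scope classical_set_scope.
Local Open Scope ring_scope.

(** Extreme points are tested by two-sided perturbation: an extreme point of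
    [convex_hull A] belongs to [A] ([extreme_convex_hull]), and if moving it
    by both [d] and [- d] stays in [A], then [d = 0] ([extreme_perturb]).

    Let [(x, y)] be extreme for [SU r u], and write [s] for the sum of the
    [x i * y i], so that [0 < r <= s].  With [x] fixed, the conditions on [y]
    define a polyhedron, and the perturbations of [y] show that it is at one of
    its vertices ([extreme_perturb_y]).
    - Scaling [y] by [1 +- (s - r) / s] keeps the sum at least [r]; as [y] is
      nonzero, [s = r] ([extreme_sum]).
    - Some term [x t * y t] is positive.  If [y j] were positive for another
      [j], mass could be exchanged between [y t] and [y j] in the ratio
      [x j : x t] without changing the sum ([extreme_y_support]).
    Hence [y] is supported on [t], and [x t * y t = r].  For [j != t], the
    coordinate [x j] no longer enters the sum because [y j = 0], so an integer
    [x j] strictly between [0] and [u j] could be moved by [+- 1]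
    ([extreme_x_bound]). *)

Section ExtremeHull.
Context {R : realType} {M : lmodType R}.
Implicit Types (A : set (convex_lmodType M)) (z : convex_lmodType M).

(** Removing an extreme point [z] from the hull leaves a convex set; if [z]
    were not in [A], that set would contain [A], hence the whole hull. *)
Lemma extreme_convex_hull A z : extreme_point (convex_hull A) z -> A z.
Proof.
move=> [hullz extz]; apply: contrapT => nAz.
pose H := [set w | convex_hull A w /\ w <> z].
suff : H z by case.
have AH : A `<=` H.
  move=> a Aa; split; first exact: sub_gen_smallest Aa.
  by move=> az; apply: nAz; rewrite -az.
suff convH : convex_set H by exact: (smallest_sub convH AH).
apply/convex_setW => a b /set_mem[hulla az] /set_mem[hullb bz] k k0 k1.
apply/mem_set; split.
  move=> C [convC AC]; apply/set_mem/convC; apply/mem_set; first exact: hulla.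
  exact: hullb.
move=> abz; have ab := extz a b k hulla hullb k0 k1 (esym abz).
by apply: az; rewrite -abz -ab convmm.
Qed.

Lemma extreme_perturb A z (d : M) : extreme_point (convex_hull A) z ->
  A (z - d : M) -> A (z + d : M) -> d = 0.
Proof.
move=> [_ extz] Am Ap.
have half_ge0 : 0 <= 2^-1 :> R by lra.
have half_le1 : 2^-1 <= 1 :> R by lra.
have zmid : z = @conv R (convex_lmodType M) (Itv01 half_ge0 half_le1)
    (z - d : M) (z + d : M).
  rewrite /conv/= (_ : unstable.onem _ = 2^-1); last first.
    by rewrite /unstable.onem; lra.
  rewrite -scalerDr addrACA addNr addr0 -mulr2n -scaler_nat scalerA.
  by rewrite mulVf ?scale1r// pnatr_eq0.
have half_gt0 : 0 < (Itv01 half_ge0 half_le1)%:num by rewrite /=; lra.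
have half_lt1 : (Itv01 half_ge0 half_le1)%:num < 1 by rewrite /=; lra.
have /addrI/eqP := extz _ _ _
  (sub_gen_smallest Am) (sub_gen_smallest Ap) half_gt0 half_lt1 zmid.
rewrite eq_sym -subr_eq0 opprK -mulr2n -scaler_nat scaler_eq0 pnatr_eq0/=.
by move/eqP.
Qed.

End ExtremeHull.

Section ExtremeSU.
Context {R : realType} {n : nat} {r : R} {u : 'I_n -> nat}.
Implicit Types x y d : 'rV[R]_n.

(** The conditions on [d] say that both [y - d] and [y + d] are feasible. *)
Lemma extreme_perturb_y x y d : extreme_point (convex_hull (SU r u)) (x, y) ->
  (forall i, `|d ord0 i| <= y ord0 i) ->
  `|\sum_(i < n) x ord0 i * d ord0 i|
    <= \sum_(i < n) x ord0 i * y ord0 i - r ->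
  d = 0.
Proof.
move=> ext dy dsum; have [/= xnat _ _ xu] := extreme_convex_hull _ _ ext.
have feasible (e : 'rV[R]_n) : (forall i, `|e ord0 i| <= y ord0 i) ->
    `|\sum_(i < n) x ord0 i * e ord0 i|
      <= \sum_(i < n) x ord0 i * y ord0 i - r ->
    SU r u (x, y + e).
  move=> ey esum; split=> //= [i|].
    by rewrite mxE; have := ey i; rewrite ler_norml; lra.
  under eq_bigr do rewrite mxE mulrDr.
  by rewrite big_split/=; move: esum; rewrite ler_norml; lra.
suff : (0, d) = 0 :> 'rV[R]_n * 'rV[R]_n by case.
apply: (extreme_perturb _ _ _ ext).
  rewrite (_ : _ - _ = (x, y + - d)); last by congr (_, _); rewrite /= subr0.
  apply: feasible => [i|]; first by rewrite mxE normrN.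
  by under eq_bigr do rewrite mxE mulrN; rewrite sumrN normrN.
rewrite (_ : _ + _ = (x, y + d)); last by congr (_, _); rewrite /= addr0.
exact: feasible.
Qed.

Lemma extreme_sum x y : 0 < r ->
  extreme_point (convex_hull (SU r u)) (x, y) ->
  \sum_(i < n) x ord0 i * y ord0 i = r.
Proof.
move=> r_gt0 ext; have [/= _ y_ge0 s_ge _] := extreme_convex_hull _ _ ext.
set s := \sum_(i < n) _ in s_ge *; have s_gt0 : 0 < s by lra.
have c_ge0 : 0 <= (s - r) / s by apply: divr_ge0; lra.
have c_le1 : (s - r) / s <= 1 by rewrite ler_pdivrMr//; lra.
have /eqP : ((s - r) / s) *: y = 0.
  apply: (extreme_perturb_y _ _ _ ext) => [i|].
    by rewrite mxE ger0_norm ?(mulr_ge0 c_ge0)// ler_piMl.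
  under eq_bigr do rewrite mxE mulrCA.
  by rewrite -mulr_sumr -/s divfK ?gt_eqF// ger0_norm ?subr_ge0.
rewrite scaler_eq0 mulf_eq0 invr_eq0 (gt_eqF s_gt0) orbF subr_eq0.
case/orP => /eqP// y0; suff : s = 0 by lra.
by rewrite /s big1// => i _; rewrite y0 mxE mulr0.
Qed.

(** The perturbation changes [y i] by its fraction [x j * y j / r] and [y j] by
    its fraction [x i * y i / r], with opposite signs, so that the two changes
    of the sum cancel.  Neither fraction exceeds [1], since [x i * y i] and
    [x j * y j] are terms of a nonnegative sum equal to [r]; hence both moved
    points stay nonnegative. *)
Lemma extreme_y_support x y i j : 0 < r ->
  extreme_point (convex_hull (SU r u)) (x, y) ->
  0 < x ord0 i * y ord0 i -> j != i -> y ord0 j = 0.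
Proof.
move=> r_gt0 ext xyi_gt0 ji.
have [/= x_nat y_ge0 _ _] := extreme_convex_hull _ _ ext.
have sum_r := extreme_sum _ _ r_gt0 ext.
have xy_ge0 k : 0 <= x ord0 k * y ord0 k by rewrite mulr_ge0// natr_ge0.
have xy_le k : x ord0 k * y ord0 k / r <= 1.
  rewrite ler_pdivrMr// mul1r -sum_r (bigD1 k)//= lerDl.
  by apply: sumr_ge0 => l _.
pose d : 'rV[R]_n := \row_k
  (if k == i then x ord0 j * y ord0 j / r * y ord0 i
   else if k == j then - (x ord0 i * y ord0 i / r * y ord0 j) else 0).
have /rowP/(_ j) : d = 0.
  apply: (extreme_perturb_y _ _ _ ext) => [k|].
    have c_ge0 l : 0 <= x ord0 l * y ord0 l / r by rewrite divr_ge0// ltW.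
    rewrite mxE; case: eqP => [->|_].
      by rewrite ger0_norm ?(mulr_ge0 (c_ge0 j))// ler_piMl.
    case: eqP => [->|_]; last by rewrite normr0.
    by rewrite normrN ger0_norm ?(mulr_ge0 (c_ge0 i))// ler_piMl.
  rewrite sum_r subrr (bigD1 i)//= (bigD1 j)//= big1 => [|k /andP[ki kj]].
    by rewrite !mxE !eqxx (negbTE ji) normr_le0; apply/eqP; ring.
  by rewrite mxE (negbTE ki) (negbTE kj) mulr0.
rewrite !mxE (negbTE ji) eqxx => /eqP.
by rewrite oppr_eq0 mulf_eq0 (gt_eqF (divr_gt0 xyi_gt0 r_gt0)) => /eqP.
Qed.

(** Where [y j = 0], moving [x j] does not change the sum. *)
Lemma extreme_x_bound x y j : extreme_point (convex_hull (SU r u)) (x, y) ->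
  y ord0 j = 0 -> x ord0 j = 0 \/ x ord0 j = (u j)%:R.
Proof.
move=> ext yj; have [/= x_nat y_ge0 s_ge x_le] := extreme_convex_hull _ _ ext.
have /natrP[m xj] := x_nat j.
have := x_le j; rewrite xj ler_nat => m_le.
have [->|m_neq0] := eqVneq m 0%N; first by left.
have [->|m_neqU] := eqVneq m (u j); first by right.
have feasible (e : R) : m%:R + e \is a Num.nat -> m%:R + e <= (u j)%:R ->
    SU r u (x + e *: delta_mx ord0 j, y).
  move=> e_nat e_le; split=> //= [i||i].
  - rewrite !mxE eqxx/=; case: eqP => [->|_]; first by rewrite mulr1 xj.
    by rewrite mulr0 addr0.
  - rewrite (eq_bigr (fun i => x ord0 i * y ord0 i))// => i _.
    rewrite !mxE eqxx/=; case: eqP => [->|_]; first by rewrite yj !mulr0.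
    by rewrite mulr0 addr0.
  - rewrite !mxE eqxx/=; case: eqP => [->|_]; first by rewrite mulr1 xj.
    by rewrite mulr0 addr0.
have : (delta_mx ord0 j, 0) = 0 :> 'rV[R]_n * 'rV[R]_n.
  apply: (extreme_perturb _ _ _ ext).
    rewrite (_ : _ - _ = (x + (-1) *: delta_mx ord0 j, y)); last first.
      by congr (_, _); rewrite /= ?scaleN1r ?subr0.
    have m_pred : m%:R + -1 = (m - 1)%:R :> R by rewrite natrB ?lt0n.
    by apply: feasible; rewrite m_pred// ler_nat (leq_trans (leq_subr _ _)).
  rewrite (_ : _ + _ = (x + 1 *: delta_mx ord0 j, y)); last first.
    by congr (_, _); rewrite /= ?scale1r ?addr0.
  by apply: feasible; rewrite natr1// ler_nat ltn_neqAle m_neqU.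
by case=> /matrixP/(_ ord0 j)/eqP; rewrite !mxE !eqxx oner_eq0.
Qed.

End ExtremeSU.

Theorem theorem3 (R : realType) (n : nat) (hn : (1 <= n)%N)
    (r : R) (hr : 0 < r)
    (u : 'I_n -> nat) (hu : forall i, (0 < u i)%N)
    (x y : 'rV[R]_n)
    (hxy : extreme_point (convex_hull (SU r u)) (x, y)) :
  exists (t : 'I_n) (p : nat),
    [/\ (1 <= p <= u t)%N,
        x ord0 t = p%:R,
        y ord0 t = r / p%:R &
        forall j : 'I_n, j != t ->
          (x ord0 j = 0 \/ x ord0 j = (u j)%:R) /\ y ord0 j = 0].
Proof.
have [/= x_nat y_ge0 _ x_le] := extreme_convex_hull _ _ hxy.
have sum_r := extreme_sum _ _ hr hxy.
have [t xyt_gt0] : exists t, 0 < x ord0 t * y ord0 t.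
  apply: contrapT => no_pos; suff : r <= 0 by lra.
  rewrite -sum_r; apply: sumr_le0 => i _; rewrite leNgt; apply/negP => xyi_gt0.
  by apply: no_pos; exists i.
have y_eq0 j (jt : j != t) := extreme_y_support _ _ _ _ hr hxy xyt_gt0 jt.
have xyt : x ord0 t * y ord0 t = r.
  by rewrite -sum_r (bigD1 t)//= big1 ?addr0// => j jt; rewrite y_eq0 ?mulr0.
have /natrP[p xt] := x_nat t.
have p_neq0 : p != 0%N.
  by apply: contraTneq xyt_gt0 => p0; rewrite xt p0 mul0r ltxx.
exists t, p; split=> //.
- by rewrite lt0n p_neq0 -(ler_nat R) -xt x_le.
- by rewrite -xyt xt mulrAC mulfV ?mul1r// pnatr_eq0.
- by move=> j jt; split; [apply: (extreme_x_bound _ _ _ hxy)|]; apply: y_eq0.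
Qed.
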